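(* Let $n\ge 2$ and let $X=\mathbb{C}^n\setminus\{(0,\ldots,0)\}$. There is no threshold sequence for $X$; that is, for no exhaustion function $\rho$ on $X$ does there exist a threshold sequence for $(X,\rho)$.
   Context: A discrete subset of a complex manifold $X$ is a subset without accumulation points in $X$. An automorphism of $X$ is a biholomorphic self-map of $X$. An exhaustion function on $X$ is a continuous function $\rho:X\to\mathbb{R}^+$ (non-negative reals) all of whose sublevel sets $\{x\in X:\rho(x)\le c\}$ are compact. An infinite discrete subset $D\subset X$ is called tame if for every exhaustion function $\rho:X\to\mathbb{R}^+$ and every map $\zeta:D\to\mathbb{R}^+$ there exists an automorphism $\phi$ of $X$ such that $\rho(\phi(x))\ge\zeta(x)$ for all $x\in D$. Given an exhaustion function $\rho$ on $X$, a sequence of positive real numbers $(R_m)_{m\in\mathbb{N}}$ is called a threshold sequence for $(X,\rho)$ if every infinite discrete subset $D\subset X$ with $\#\{x\in D:\rho(x)\le R_m\}<m$ for all $m\in\mathbb{N}$ ($m\ge 1$) is tame. *)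

(* Defs.v *)
From HB Require Import structures.
From mathcomp Require Import all_boot all_order all_algebra.
From mathcomp Require Import complex.
From mathcomp Require Import all_classical all_reals all_analysis.
Set Implicit Arguments.
Unset Strict Implicit.
Unset Printing Implicit Defensive.
Import Order.TTheory GRing.Theory Num.Theory.
Import numFieldNormedType.Exports.
Local Open Scope classical_set_scope.
Local Open Scope card_scope.
Local Open Scope complex_scope.
Local Open Scope ring_scope.

(* The complex manifolds considered here are the open subsets X of a complex
   normed space V.  Maps defined on X are represented by total functions on V
   whose values outside X are irrelevant. *)
Section ComplexManifold.
Context {R : realType} {V : normedModType R[i]}.
Implicit Types (X D : set V) (phi psi : V -> V) (rho zeta : V -> R).

(* [differentiable] is Frechet differentiability over the scalar field of V,
   here R[i]: the differential is C-linear. *)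
Definition holomorphic_on X phi := forall x, X x -> differentiable phi x.

Definition automorphism X phi :=
  [/\ set_bij X X phi, holomorphic_on X phi &
      exists psi, [/\ set_fun X X psi, {in X, cancel phi psi} &
                      holomorphic_on X psi]].

Definition discrete_in X D := D `<=` X /\ X `&` limit_point D = set0.

Definition sublevel X rho (c : R) : set V := [set x | X x /\ rho x <= c].

Definition exhaustion X rho :=
  [/\ {within X, continuous rho}, (forall x, X x -> 0 <= rho x) &
      (forall c : R, compact (sublevel X rho c))].

Definition tame X D :=
  [/\ infinite_set D, discrete_in X D &
      forall rho zeta, exhaustion X rho -> (forall x, D x -> 0 <= zeta x) ->
        exists2 phi, automorphism X phi &
          forall x, D x -> zeta x <= rho (phi x)].

Definition card_lt (A : set V) (m : nat) := exists2 k, (k < m)%N & A #= `I_k.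

(* Threshold sequences are indexed from 1; the value r 0 plays no role. *)
Definition threshold_sequence X rho (r : nat -> R) :=
  (forall m, (1 <= m)%N -> 0 < r m) /\
  (forall D, infinite_set D -> discrete_in X D ->
     (forall m, (1 <= m)%N -> card_lt (sublevel D rho (r m)) m) ->
     tame X D).

End ComplexManifold.

Definition punctured_space (R : realType) (n : nat) : set 'rV[R[i]]_n :=
  [set z | z != 0].
Arguments punctured_space : clear implicits.

(* Main.v *)
Require Import Defs.
From mathcomp Require Import all_boot all_order all_algebra complex.
From mathcomp Require Import all_classical all_reals all_analysis.
From mathcomp Require Import ring lra.
Import Order.TTheory GRing.Theory Num.Theory.
Import numFieldNormedType.Exports.
Import ComplexField.Normc.
Set Implicit Arguments.
Unset Strict Implicit.
Unset Printing Implicit Defensive.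
Local Open Scope classical_set_scope.
Local Open Scope complex_scope.
Local Open Scope ring_scope.

(** Every exhaustion function tends to infinity at the puncture, so, whatever
the numbers [r m] are, a sequence of nonzero vectors can tend to 0 so fast that
fewer than [m] of its terms lie in the sublevel set at [r m]
([sparse_null_sequence]).  The range of such a sequence is infinite and discrete
in the punctured space, and it is never tame ([not_tame_near_0]).

The obstruction to tameness is Hartogs' phenomenon: in dimension at least 2 an
automorphism [phi] of the punctured space cannot push points near 0 far away,
nor bring them much closer to 0.  Through every nonzero vector there is a
complex line that misses 0; on this line [phi] is an entire function of one
variable, so its values near 0 are controlled by its values on a compact set
away from 0 ([bounded_near_0]).  The inverse [psi] is bounded near 0 for the
same reason, tends to 0 there because [phi] is bounded away from 0 on compact
annuli ([inverse_tends_to_0]), and then satisfies [rnorm (psi y) <= K * rnorm y]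
by the Cauchy estimate along such lines ([linear_bound]).  Hence, for [x] small
enough depending on [phi], the point [phi x] lies in the annulus [rnorm x ^+ 2
<= rnorm y <= (rnorm x)^-1].  This annulus is compact and does not depend on
[phi], so a prescribed lower bound [zeta x] that exceeds the maximum of [rho] on
it is reached by no automorphism.

The one-variable theory that this requires is the estimate of a function at the
centre of a square by its values on the boundary ([centre_bound]), for functions
that are only known to be complex differentiable at each point.  It is obtained
from Goursat's subdivision argument.  Contour integrals are replaced by the
midpoint sums that cut each side of a square into [3 ^ N] pieces: the sum of
order [N + 1] over a square is exactly the total of the sums of order [N] over
its nine thirds, and the sums vanish on affine functions, so the subdivision
argument shows that they tend to 0 as [N] grows ([goursat]).  Cutting into
thirds rather than halves keeps the centre of the square at the centre of one of
the pieces, which is how a singularity of Cauchy kernel type at the centre is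
treated ([goursat_punctured]). *)

(** * The modulus of complex numbers and nested squares *)

Section OneVariable.
Context {R : realType}.
Local Notation C := R[i].
Implicit Types (z : C) (s t l : R).

Lemma normc_ge0 z : 0 <= normc z.
Proof. by case: z => a b /=; rewrite sqrtr_ge0. Qed.

Lemma normc_gt0 z : z != 0 -> 0 < normc z.
Proof.
move=> z0; rewrite lt_neqAle normc_ge0 andbT eq_sym.
by apply: contra z0 => /eqP /eq0_normc ->.
Qed.

Lemma normcD_le (z w : C) : normc (z + w) <= normc z + normc w.
Proof. exact: le_normcD. Qed.

Lemma normcB_le (z w : C) : normc (z - w) <= normc z + normc w.
Proof. by apply: le_trans (normcD_le _ _) _; rewrite normcN. Qed.

Lemma normcR (x : R) : normc x%:C = `|x|.
Proof. by rewrite /= expr0n /= addr0 sqrtr_sqr. Qed.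

Lemma Re_le_normc z : `|complex.Re z| <= normc z.
Proof. by case: z => a b /=; rewrite -sqrtr_sqr ler_wsqrtr // lerDl sqr_ge0. Qed.

Lemma Im_le_normc z : `|complex.Im z| <= normc z.
Proof. by case: z => a b /=; rewrite -sqrtr_sqr ler_wsqrtr // lerDr sqr_ge0. Qed.

Lemma normc_le_ReIm (a b : R) : normc (a +i* b) <= `|a| + `|b|.
Proof.
have -> : a +i* b = a%:C + 'i * b%:C by rewrite [LHS]complexE.
apply: le_trans (normcD_le _ _) _.
by rewrite normcM !normcR /= expr0n expr1n /= add0r sqrtr1 mul1r.
Qed.

Lemma exists_geometric_lt l (d : R) : 0 < d -> exists n, l / 3 ^+ n < d.
Proof.
move=> d0; have := @cvg_geometric R l 3^-1 ltac:(by rewrite ger0_norm; lra).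
move=> /cvgrPdist_lt /(_ d d0) [n _ /(_ n (leqnn n))] /=.
rewrite sub0r normrN exprVn => hn; exists n.
by apply: le_lt_trans (ler_norm _) hn.
Qed.

Definition thirds s l := [:: s; s + l / 3; s + l / 3 + l / 3].

(** A property of squares that passes from the nine thirds of a square to the
square itself, and that holds for all small squares around each point, holds
for the whole square: otherwise successive bad thirds shrink to a point around
which the property fails.  Both Goursat's argument and the mean value
inequality are instances.  A square is given by the coordinates [s], [t] of its
lower left corner and its side [l]. *)
Lemma square_induction (P : R -> R -> R -> Prop) s t l :
    0 < l ->
    (forall s t l, 0 < l ->
      (forall s' t', s' \in thirds s l -> t' \in thirds t l -> P s' t' (l / 3)) ->
      P s t l) ->
    (forall x y, s <= x <= s + l -> t <= y <= t + l ->
      exists2 d, 0 < d & forall s' t' l', 0 < l' -> l' < d ->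
        s' <= x <= s' + l' -> t' <= y <= t' + l' ->
        s <= s' -> s' + l' <= s + l -> t <= t' -> t' + l' <= t + l ->
        P s' t' l') ->
  P s t l.
Proof.
move=> l0 Psub Ploc; apply: contrapT => nP.
pose bad (q : R * R * R) := 0 < q.2 /\ ~ P q.1.1 q.1.2 q.2.
pose inside (q q' : R * R * R) :=
  [/\ q'.2 = q.2 / 3, q.1.1 <= q'.1.1, q'.1.1 + q'.2 <= q.1.1 + q.2,
      q.1.2 <= q'.1.2 & q'.1.2 + q'.2 <= q.1.2 + q.2].
have step q : exists q', bad q -> bad q' /\ inside q q'.
  have [[q0 nPq]|nb] := pselect (bad q); last by exists q.
  apply: contrapT => none; apply: nPq; apply: Psub => // s' t' hs ht.
  apply: contrapT => nP'; apply: none; exists (s', t', q.2 / 3) => _.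
  split; first by split => //=; lra.
  move: hs ht; rewrite !inE /inside /=.
  by move=> /or3P[] /eqP -> /or3P[] /eqP ->; split => //; lra.
have [next nextP] := choice step.
pose u n := iter n next (s, t, l).
have ubad n : bad (u n).
  by elim: n => [|n IH]; [split | have [] := nextP _ IH].
have uin n : inside (u n) (u n.+1) by have [] := nextP _ (ubad n).
have usz n : (u n).2 = l / 3 ^+ n.
  elim: n => [|n IH]; first by rewrite expr0 divr1.
  have [-> _ _ _ _] := uin n; rewrite IH exprSr invfM mulrA; ring.
have um n k : [/\ (u n).1.1 <= (u (n + k)%N).1.1,
    (u (n + k)%N).1.1 + (u (n + k)%N).2 <= (u n).1.1 + (u n).2,
    (u n).1.2 <= (u (n + k)%N).1.2 &
    (u (n + k)%N).1.2 + (u (n + k)%N).2 <= (u n).1.2 + (u n).2].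
  elim: k => [|k [i1 i2 i3 i4]]; first by rewrite addn0; split.
  rewrite addnS; have [_ j1 j2 j3 j4] := uin (n + k)%N.
  split; [exact: le_trans j1 | exact: le_trans i2 | exact: le_trans j3 |].
  exact: le_trans i4.
have upos n : 0 < (u n).2 by have [] := ubad n.
(* The corner coordinates of nested squares increase and stay below the
   coordinates of the opposite corners, so they have suprema. *)
have bracket (a : nat -> R) (b : nat -> R) : (forall n k, a n <= a (n + k)%N) ->
    (forall n k, b (n + k)%N <= b n) -> (forall n, a n <= b n) ->
    exists x, forall n, a n <= x <= b n.
  move=> am bm ab.
  have ub n : ubound (range a) (b n).
    move=> _ [m _ <-]; apply: (@le_trans _ _ (a (m + n)%N)) => //.
    by rewrite addnC; apply: le_trans (bm n m).
  exists (sup (range a)) => n; apply/andP; split.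
    by apply: ub_le_sup; [exists (b 0%N); exact: ub | exists n].
  by apply: ge_sup; [exists (a 0%N), 0%N | exact: ub].
have [x xP] := bracket (fun n => (u n).1.1) (fun n => (u n).1.1 + (u n).2)
  (fun n k => let: And4 h _ _ _ := um n k in h)
  (fun n k => let: And4 _ h _ _ := um n k in h)
  (fun n => ltac:(by rewrite lerDl ltW)).
have [y yP] := bracket (fun n => (u n).1.2) (fun n => (u n).1.2 + (u n).2)
  (fun n k => let: And4 _ _ h _ := um n k in h)
  (fun n k => let: And4 _ _ _ h := um n k in h)
  (fun n => ltac:(by rewrite lerDl ltW)).
have [d d0 dP] := Ploc x y (xP 0%N) (yP 0%N).
have [n nd] := exists_geometric_lt l d0.
have [_ []] := ubad n; have [i1 i2 i3 i4] := um 0%N n.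
by apply: (dP _ _ _ (upos n)); rewrite ?usz //=; rewrite -?usz.
Qed.

End OneVariable.

(** * Goursat's theorem for triadic midpoint sums *)

Section Goursat.
Context {R : realType}.
Local Notation C := R[i].
Implicit Types (h f g : C -> C) (z p c : C) (s t l : R) (N : nat).

(** Differentiability at a single point, the one-variable form of Frechet
differentiability. *)
Definition cderiv f p c := forall e : R, 0 < e -> exists2 d : R, 0 < d &
  forall z, normc (z - p) < d ->
    normc (f z - f p - c * (z - p)) <= e * normc (z - p).

Definition square s t l z :=
  s <= complex.Re z <= s + l /\ t <= complex.Im z <= t + l.

(** The mean of the values of [g] at the midpoints of the [3 ^ N] equal pieces of
[[s, s + l]].  The recursion makes the subdivision of a side hold by definition. *)
Fixpoint midpoint_mean N (g : R -> C) s l : C :=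
  if N is N'.+1 then
    (midpoint_mean N' g s (l / 3) + midpoint_mean N' g (s + l / 3) (l / 3) +
     midpoint_mean N' g (s + l / 3 + l / 3) (l / 3)) / 3
  else g (s + l / 2).

Lemma midpoint_mean_ind (P : C -> Prop) (g : R -> C) N s l :
  (forall a b c, P a -> P b -> P c -> P ((a + b + c) / 3)) -> 0 <= l ->
  (forall x, s <= x <= s + l -> P (g x)) -> P (midpoint_mean N g s l).
Proof.
move=> Pm; elim: N s l => [|N IH] s l l0 Pg /=; first by apply: Pg; lra.
by apply: Pm; apply: IH; try lra; move=> x hx; apply: Pg; lra.
Qed.

Lemma midpoint_meanD (g1 g2 : R -> C) N s l :
  midpoint_mean N (fun x => g1 x + g2 x) s l =
  midpoint_mean N g1 s l + midpoint_mean N g2 s l.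
Proof. by elim: N s l => [//|N IH] s l /=; rewrite !IH; ring. Qed.

Lemma midpoint_meanZ (c : C) (g : R -> C) N s l :
  midpoint_mean N (fun x => c * g x) s l = c * midpoint_mean N g s l.
Proof. by elim: N s l => [//|N IH] s l /=; rewrite !IH; ring. Qed.

Lemma midpoint_mean_affine (a b : C) N s l :
  midpoint_mean N (fun x => a * x%:C + b) s l = a * (s + l / 2)%:C + b.
Proof.
elim: N s l => [//|N IH] s l /=; rewrite !IH.
have -> : s + l / 3 + l / 3 + l / 3 / 2 = (s + l / 2) + l / 3 by lra.
have -> : s + l / 3 + l / 3 / 2 = s + l / 2 by lra.
have -> : s + l / 3 / 2 = (s + l / 2) - l / 3 by lra.
by rewrite !(rmorphD, rmorphN) /=; field.
Qed.

Lemma eq_midpoint_mean (g1 g2 : R -> C) N s l :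
  g1 =1 g2 -> midpoint_mean N g1 s l = midpoint_mean N g2 s l.
Proof. by move=> e; elim: N s l => [|N IH] s l /=; rewrite ?e // !IH. Qed.

Lemma ReIm_sum (a b : R) : a +i* b = a%:C + 'i * b%:C.
Proof. exact: complexE. Qed.

(** The midpoint sum for the integral of [h] along the boundary of a square,
counterclockwise.  The top and left sides are run through in the positive
direction and counted negatively. *)
Definition contour_sum N h s t l : C :=
  l%:C * (midpoint_mean N (fun x => h (x +i* t)) s l
          + 'i * midpoint_mean N (fun y => h ((s + l) +i* y)) t l
          - midpoint_mean N (fun x => h (x +i* (t + l))) s l
          - 'i * midpoint_mean N (fun y => h (s +i* y)) t l).

Lemma contour_sumD h g N s t l :
  contour_sum N (fun z => h z + g z) s t l =
  contour_sum N h s t l + contour_sum N g s t l.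
Proof. by rewrite /contour_sum !midpoint_meanD; ring. Qed.

Lemma contour_sumZ c h N s t l :
  contour_sum N (fun z => c * h z) s t l = c * contour_sum N h s t l.
Proof. by rewrite /contour_sum !midpoint_meanZ; ring. Qed.

Lemma eq_contour_sum h g N s t l :
  h =1 g -> contour_sum N h s t l = contour_sum N g s t l.
Proof. by move=> e; congr (contour_sum N _ s t l); apply/funext. Qed.

(** The midpoint rule is exact for affine functions, whose integral along a closed
curve is 0. *)
Lemma contour_sum_affine (a b : C) N s t l :
  contour_sum N (fun z => a * z + b) s t l = 0.
Proof.
have hor y : midpoint_mean N (fun x : R => a * (x +i* y) + b) s l =
    a * (s + l / 2)%:C + (a * ('i * y%:C) + b).
  rewrite -(midpoint_mean_affine _ _ N); apply: eq_midpoint_mean => x.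
  by rewrite ReIm_sum; ring.
have ver x : midpoint_mean N (fun y : R => a * (x +i* y) + b) t l =
    (a * 'i) * (t + l / 2)%:C + (a * x%:C + b).
  rewrite -(midpoint_mean_affine _ _ N); apply: eq_midpoint_mean => y.
  by rewrite ReIm_sum; ring.
rewrite /contour_sum !hor !ver !rmorphD /=.
by ring.
Qed.

(** Inner sides are shared by two of the nine squares and cancel. *)
Lemma contour_sum_split N h s t l :
  let m := l / 3 in
  contour_sum N.+1 h s t l =
    contour_sum N h s t m + contour_sum N h (s + m) t m
     + contour_sum N h (s + m + m) t m
  + (contour_sum N h s (t + m) m + contour_sum N h (s + m) (t + m) m
     + contour_sum N h (s + m + m) (t + m) m)
  + (contour_sum N h s (t + m + m) m + contour_sum N h (s + m) (t + m + m) m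
     + contour_sum N h (s + m + m) (t + m + m) m).
Proof.
move=> m; rewrite /contour_sum /= -/m.
have E r : r + m + m + m = r + l by rewrite /m; lra.
rewrite !E.
have -> : l%:C = 3 * m%:C.
  rewrite -[3]/(3%:R) -(rmorph_nat (real_complex R)) -rmorphM /= /m.
  by congr (_ %:C); lra.
by field.
Qed.

Definition boundary s t l z :=
  (s <= complex.Re z <= s + l /\ (complex.Im z = t \/ complex.Im z = t + l)) \/
  (t <= complex.Im z <= t + l /\ (complex.Re z = s \/ complex.Re z = s + l)).

Lemma normc_midpoint_mean_le (g : R -> C) (B : R) N s l : 0 <= l ->
  (forall x, s <= x <= s + l -> normc (g x) <= B) -> normc (midpoint_mean N g s l) <= B.
Proof.
apply: (midpoint_mean_ind (P := fun z => normc z <= B)) => a b c ha hb hc.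
rewrite normcM normcV.
have -> : normc (3 : C) = 3 :> R.
  by have := normcR (3 : R); rewrite rmorph_nat ger0_norm.
have := normcD_le (a + b) c; have := normcD_le a b; lra.
Qed.

Lemma normc_contour_sum_le h (B : R) N s t l : 0 <= l ->
  (forall z, boundary s t l z -> normc (h z) <= B) ->
  normc (contour_sum N h s t l) <= 4 * l * B.
Proof.
move=> l0 hB; rewrite /contour_sum normcM normcR ger0_norm //.
set m1 := midpoint_mean _ _ _ _; set m2 := midpoint_mean _ _ _ _.
set m3 := midpoint_mean _ _ _ _; set m4 := midpoint_mean _ _ _ _.
have b1 : normc m1 <= B.
  by apply: normc_midpoint_mean_le => // x hx; apply: hB; left; split => //; left.
have b2 : normc m2 <= B.
  by apply: normc_midpoint_mean_le => // x hx; apply: hB; right; split => //; right.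
have b3 : normc m3 <= B.
  by apply: normc_midpoint_mean_le => // x hx; apply: hB; left; split => //; right.
have b4 : normc m4 <= B.
  by apply: normc_midpoint_mean_le => // x hx; apply: hB; right; split => //; left.
have ni w : normc ('i * w) = normc w.
  by rewrite normcM /= expr0n expr1n /= add0r sqrtr1 mul1r.
have : normc (m1 + 'i * m2 - m3 - 'i * m4) <= 4 * B.
  have := normcB_le (m1 + 'i * m2 - m3) ('i * m4).
  have := normcB_le (m1 + 'i * m2) m3.
  have := normcD_le m1 ('i * m2).
  rewrite !ni; lra.
by move=> /(ler_wpM2l l0); lra.
Qed.

Lemma square_diam s t l (z w : C) : square s t l z -> square s t l w ->
  normc (z - w) <= 2 * l.
Proof.
case: z w => [a b] [c d]; rewrite /square /= => -[h1 h2] [h3 h4].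
apply: le_trans (normc_le_ReIm _ _) _.
have : `|a - c| <= l by rewrite ler_norml; lra.
have : `|b - d| <= l by rewrite ler_norml; lra.
lra.
Qed.

Lemma boundary_square s t l z : 0 <= l -> boundary s t l z -> square s t l z.
Proof. by rewrite /boundary /square; lra. Qed.

Definition eventually_le h s t l (B : R) :=
  exists N0, forall N, (N0 <= N)%N -> normc (contour_sum N h s t l) <= B.

(** The sum over a square of order [N.+1] is the total of nine sums of order [N], so
bounds on the thirds add up; they may differ because one third may contain a
singularity. *)
Lemma eventually_le_split h s t l (b : R -> R -> R) :
  let m := l / 3 in
  (forall s' t', s' \in thirds s l -> t' \in thirds t l ->
     eventually_le h s' t' m (b s' t')) ->
  eventually_le h s t l
    (b s t + b (s + m) t + b (s + m + m) t
     + (b s (t + m) + b (s + m) (t + m) + b (s + m + m) (t + m))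
     + (b s (t + m + m) + b (s + m) (t + m + m) + b (s + m + m) (t + m + m))).
Proof.
move=> m hb.
have /choice[F FP] (q : R * R) : exists N0,
    q.1 \in thirds s l -> q.2 \in thirds t l -> forall N, (N0 <= N)%N ->
    normc (contour_sum N h q.1 q.2 m) <= b q.1 q.2.
  have [/andP[h1 h2]|no] := boolP ((q.1 \in thirds s l) && (q.2 \in thirds t l)).
    by have [N0 ?] := hb _ _ h1 h2; exists N0.
  by exists 0%N => h1 h2; rewrite h1 h2 in no.
pose M := (\max_(a <- thirds s l) \max_(c <- thirds t l) F (a, c))%N.
have E N (a c : R) : (M <= N)%N -> a \in thirds s l -> c \in thirds t l ->
    normc (contour_sum N h a c m) <= b a c.
  move=> MN ha hc; apply: (FP (a, c) ha hc); apply: leq_trans MN.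
  by apply: (@bigmaxn_sup_seq _ _ a) => //; apply: (@bigmaxn_sup_seq _ _ c).
have in0 (a : R) : a \in thirds a l by rewrite !inE eqxx.
have in1 (a : R) : a + m \in thirds a l by rewrite !inE eqxx ?orbT.
have in2 (a : R) : a + m + m \in thirds a l by rewrite !inE eqxx ?orbT.
exists M.+1 => -[//|N] MN; rewrite contour_sum_split -/m.
have D3 (x y z : C) (bx b_y bz : R) : normc x <= bx -> normc y <= b_y ->
    normc z <= bz -> normc (x + y + z) <= bx + b_y + bz.
  move=> hx hy hz; have := normcD_le (x + y) z; have := normcD_le x y; lra.
by do 2!apply: (D3); apply: (E).
Qed.

(** On a square of side [l'] close to a point [p], subtracting the affine Taylor
polynomial at [p], which does not change the sum, leaves a function of size
[o(l')] and hence a sum of size [o(l' ^+ 2)]; such bounds, proportional to the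
area, add up over subdivisions. *)
Lemma goursat h s t l : 0 < l ->
  (forall z, square s t l z -> exists c, cderiv h z c) ->
  forall e : R, 0 < e -> eventually_le h s t l e.
Proof.
move=> l0 hd e e0.
(* The error allowed per unit of area. *)
pose k := e / l ^+ 2.
have k0 : 0 < k by rewrite /k divr_gt0 // exprn_gt0.
pose P s' t' l' := eventually_le h s' t' l' (k * l' ^+ 2).
suff : P s t l by rewrite /P /k divfK // expf_neq0 // gt_eqF.
apply: (@square_induction R P) => // [s' t' l' l'0 IH|x y hx hy].
  have := @eventually_le_split h s' t' l' (fun _ _ => k * (l' / 3) ^+ 2) IH.
  by rewrite /P; congr eventually_le; field.
(* The factor 8 is the perimeter [4 * l'] times the diameter bound [2 * l'],
   relative to the area. *)
have [c hc] := hd (x +i* y) (conj hx hy).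
have [d d0 dP] := hc (k / 8) ltac:(lra).
exists (d / 2); first lra.
move=> s' t' l' l'0 l'd hx' hy' _ _ _ _; exists 0%N => N _.
set p := x +i* y in hc dP.
have -> : contour_sum N h s' t' l' =
    contour_sum N (fun z => h z - h p - c * (z - p)) s' t' l'.
  rewrite [RHS](eq_contour_sum (g := fun z => h z + (- c * z + (c * p - h p)))).
    by rewrite contour_sumD contour_sum_affine addr0.
  by move=> z; ring.
have -> : k * l' ^+ 2 = 4 * l' * (k / 8 * (2 * l')) by field.
apply: normc_contour_sum_le; first exact: ltW.
move=> z /(boundary_square (ltW l'0)) zs.
have zp := square_diam zs (conj hx' hy' : square s' t' l' p).
apply: le_trans (dP _ _) _; first lra.
by rewrite ler_wpM2l //; lra.
Qed.

Definition centred_square p l :=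
  square (complex.Re p - l / 2) (complex.Im p - l / 2) l.
Definition centred_boundary p l :=
  boundary (complex.Re p - l / 2) (complex.Im p - l / 2) l.
Definition centred_contour_sum N h p l :=
  contour_sum N h (complex.Re p - l / 2) (complex.Im p - l / 2) l.

Lemma centred_boundary_far p l z : centred_boundary p l z -> l / 2 <= normc (z - p).
Proof.
move: z p => [a b] [c d] hb.
have := Re_le_normc ((a +i* b) - (c +i* d)).
have := Im_le_normc ((a +i* b) - (c +i* d)).
move: (normc _) => n; move: hb; rewrite /centred_boundary /boundary /= !ler_norml.
by move=> [[_ [->|->]]|[_ [->|->]]] /andP[i1 i2] /andP[i3 i4]; lra.
Qed.

Lemma centred_square_near p l z : 0 < l -> centred_square p l z -> normc (z - p) <= l.
Proof.
move: z p => [a b] [c d]; rewrite /centred_square /square /= => l0 -[h1 h2].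
apply: le_trans (normc_le_ReIm _ _) _.
have : `|a - c| <= l / 2 by rewrite ler_norml; lra.
have : `|b - d| <= l / 2 by rewrite ler_norml; lra.
lra.
Qed.

(** The hypothesis allows [h] to have the singularity of a Cauchy kernel applied
to a function that vanishes at [p].  Goursat's theorem applies to the eight
outer thirds, so the sum over a square is asymptotically that over its middle
third, and inductively that over an arbitrarily small square around [p]; there
[h] is at most a small multiple of the inverse of the side, while the perimeter
is proportional to the side. *)
Lemma goursat_punctured h p l : 0 < l ->
  (forall z, centred_square p l z -> z != p -> exists c, cderiv h z c) ->
  (forall e : R, 0 < e -> exists2 d : R, 0 < d &
     forall z, normc (z - p) < d -> normc (h z * (z - p)) <= e) ->
  forall e : R, 0 < e ->
  exists N0, forall N, (N0 <= N)%N -> normc (centred_contour_sum N h p l) <= e.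
Proof.
move=> l0 hd hp e e0.
have [d d0 dP] := hp (e / 16) ltac:(lra).
have [n nd] := exists_geometric_lt l d0.
(* The limit of the sums must be bounded with a fixed constant, here [e / 2],
   through all the steps; [r] absorbs the outer thirds. *)
suff main r : 0 < r -> exists N0, forall N, (N0 <= N)%N ->
    normc (centred_contour_sum N h p l) <= e / 2 + r.
  by have [N0 H] := main (e / 2) ltac:(lra); exists N0 => N /H; lra.
elim: n l l0 nd hd r => [|n IH] l l0 ld hd r r0.
  exists 0%N => N _.
  have -> : e / 2 + r = 4 * l * ((e / 2 + r) / (4 * l)) by field; lra.
  apply: normc_contour_sum_le => [|z hz]; first exact: ltW.
  have far := centred_boundary_far hz.
  have near := centred_square_near l0 (boundary_square (ltW l0) hz).
  have := dP z ltac:(move: ld; rewrite expr0; lra).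
  rewrite normcM => hzp.
  have hl : normc (h z) * (l / 2) <= e / 16.
    by apply: le_trans hzp; rewrite ler_wpM2l ?normc_ge0.
  rewrite ler_pdivlMr; last lra.
  have -> : normc (h z) * (4 * l) = 8 * (normc (h z) * (l / 2)) by field.
  lra.
pose m := l / 3.
pose s := complex.Re p - l / 2.
pose t := complex.Im p - l / 2.
pose b s' t' := if (s' == s + m) && (t' == t + m) then e / 2 + r / 2 else r / 16.
have m0 : m <> 0 by rewrite /m; lra.
have n1 (a : R) : (a == a + m) = false by apply/eqP; lra.
have n2 (a : R) : (a + m + m == a + m) = false by apply/eqP; lra.
have [|N0 HN0] := @eventually_le_split h s t l b; last first.
  exists N0 => N /HN0.
  by rewrite /b -/m !eqxx !n1 !n2 /= /centred_contour_sum -/s -/t; lra.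
move=> s' t' hs' ht'; rewrite /b -/m.
have [/andP[/eqP es /eqP et]|nc] := boolP (_ && _).
  have := IH m ltac:(rewrite /m; lra) _ _ (r / 2) ltac:(lra).
  have -> : s' = complex.Re p - m / 2 by rewrite es /s /m; lra.
  have -> : t' = complex.Im p - m / 2 by rewrite et /t /m; lra.
  apply; first by move: ld; rewrite /m exprS invfM mulrA; lra.
  move=> z; rewrite /centred_square /square => hz; apply: hd.
  by rewrite /centred_square /square /m in hz *; lra.
(* An outer third lies in the square and does not contain the centre. *)
apply: goursat; [rewrite /m; lra | | lra] => z hz; apply: hd.
  move: hs' ht' hz; rewrite /centred_square /square !inE -/s -/t -/m.
  have ml : l = m + m + m by rewrite /m; lra.
  move=> /or3P[] /eqP -> /or3P[] /eqP -> [] /andP[h1 h2] /andP[h3 h4]; lra.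
apply: contraNneq nc => zp; move: hz; rewrite {}zp.
have ml : l = m + m + m by rewrite /m; lra.
move: hs' ht'; rewrite /square !inE -/s -/t -/m.
have -> : complex.Re p = s + m + m / 2 by rewrite /s; lra.
have -> : complex.Im p = t + m + m / 2 by rewrite /t; lra.
by move=> /or3P[] /eqP -> /or3P[] /eqP -> [] /andP[h1 h2] /andP[h3 h4];
  rewrite ?eqxx //; lra.
Qed.

End Goursat.

(** * Cauchy estimates on squares *)

Section CauchyEstimates.
Context {R : realType}.
Local Notation C := R[i].
Implicit Types (f g : C -> C) (z p c : C) (s t l : R) (N : nat).

(** Both Cauchy kernels and difference quotients have this form. *)
Lemma cderiv_quotient f (a : C) p z0 c : z0 != p -> cderiv f z0 c ->
  exists c', cderiv (fun z => (f z - a) / (z - p)) z0 c'.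
Proof.
move=> z0p fc; pose w := z0 - p; pose F := f z0 - a.
have w0 : w != 0 by rewrite subr_eq0.
have W0 := normc_gt0 w0.
exists (c / w - F / w ^+ 2) => e e0.
set W := normc w in W0.
have [d1 d10 d1P] := fc (e * W / 4) ltac:(by rewrite divr_gt0 ?mulr_gt0; lra).
pose K := 2 * normc F / W ^+ 3 + 2 * normc c / W ^+ 2.
have K0 : 0 <= K by rewrite addr_ge0 ?divr_ge0 ?mulr_ge0 ?normc_ge0 ?exprn_ge0 ?ltW.
exists (Num.min d1 (Num.min (W / 2) (e / (2 * K + 1)))).
  by rewrite !lt_min d10 !divr_gt0 //; lra.
move=> z; rewrite !lt_min => /and3P[zd1 zW zK].
pose u := z - z0; rewrite -/u in zd1 zW zK *.
have -> : z - p = w + u by rewrite /w /u; ring.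
pose r := f z - f z0 - c * u.
have hr : normc r <= e * W / 4 * normc u := d1P z zd1.
have -> : f z - a = F + c * u + r by rewrite /r /F; ring.
have low : W / 2 <= normc (w + u).
  have := normcB_le (w + u) u; rewrite addrK -/W; lra.
have wu0 : w + u != 0.
  by apply/eqP => E; move: low; rewrite E normc0; lra.
rewrite -/F -/w.
have -> : (F + c * u + r) / (w + u) - F / w - (c / w - F / w ^+ 2) * u =
    r / (w + u) + (F * (u ^+ 2 / (w ^+ 2 * (w + u)))
                   - c * (u ^+ 2 / (w * (w + u)))) by field; rewrite wu0 w0.
have invb : (normc (w + u))^-1 <= 2 / W.
  rewrite -[leRHS]invrK lef_pV2 ?posrE ?invr_gt0 ?divr_gt0 //; last lra.
    by rewrite invf_div.
set n := normc u in hr zd1 zW zK *.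
have n0 : 0 <= n := normc_ge0 _.
set I := (normc (w + u))^-1 in invb *.
have I0 : 0 <= I by rewrite invr_ge0 normc_ge0.
have b1 : normc (r / (w + u)) <= e / 2 * n.
  rewrite normcM normcV.
  apply: le_trans (ler_pM (normc_ge0 _) I0 hr invb) _.
  by rewrite le_eqVlt; apply/orP; left; apply/eqP; field; lra.
have b2 : normc (F * (u ^+ 2 / (w ^+ 2 * (w + u)))) <=
    2 * normc F / W ^+ 3 * n ^+ 2.
  have -> : normc (F * (u ^+ 2 / (w ^+ 2 * (w + u)))) =
      normc F * (n ^+ 2 / W ^+ 2) * I.
    by rewrite !(normcM, normcV) -/W -/n invfM -/I !expr2 !mulrA.
  have -> : 2 * normc F / W ^+ 3 * n ^+ 2 =
    normc F * (n ^+ 2 / W ^+ 2) * (2 / W) by field; lra.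
  by rewrite ler_wpM2l // mulr_ge0 ?normc_ge0 ?divr_ge0 ?sqr_ge0.
have b3 : normc (c * (u ^+ 2 / (w * (w + u)))) <= 2 * normc c / W ^+ 2 * n ^+ 2.
  have -> : normc (c * (u ^+ 2 / (w * (w + u)))) = normc c * (n ^+ 2 / W) * I.
    by rewrite !(normcM, normcV) -/W -/n invfM -/I !expr2 !mulrA.
  have -> : 2 * normc c / W ^+ 2 * n ^+ 2 =
    normc c * (n ^+ 2 / W) * (2 / W) by field; lra.
  by rewrite ler_wpM2l // mulr_ge0 ?normc_ge0 ?divr_ge0 ?sqr_ge0 // ltW.
have b4 : K * n ^+ 2 <= e / 2 * n.
  rewrite expr2 mulrA ler_wpM2r //.
  move: zK; rewrite ltr_pdivlMr; last lra.
  by rewrite mulrDr mulr1 => zK; have := mulr_ge0 n0 K0; lra.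
rewrite /K mulrDl in b4.
apply: le_trans (normcD_le _ _) _.
have := normcB_le (F * (u ^+ 2 / (w ^+ 2 * (w + u)))) (c * (u ^+ 2 / (w * (w + u)))).
lra.
Qed.

Lemma Im_midpoint_mean_ge (g : R -> C) (u : C) (B : R) N s l : 0 <= l ->
  (forall x, s <= x <= s + l -> B <= complex.Im (u * g x)) ->
  B <= complex.Im (u * midpoint_mean N g s l).
Proof.
apply: (midpoint_mean_ind (P := fun z => B <= complex.Im (u * z))) => a b c.
have -> : u * ((a + b + c) / 3) = (3^-1 : R)%:C * (u * a + u * b + u * c).
  by rewrite rmorphV ?unitfE ?pnatr_eq0 // rmorph_nat; ring.
by move: (u * a) (u * b) (u * c) => [? ?] [? ?] [? ?] /=; lra.
Qed.

(** The integral of the Cauchy kernel is [2 * pi * 'i]; a positive lower bound,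
uniform in [N], is enough.  On each side the kernel times the direction of the
side has imaginary part at least the inverse of [l], hence the constant 4. *)
Lemma Im_contour_sum_inv N p l : 0 < l ->
  4 <= complex.Im (centred_contour_sum N (fun z => (z - p)^-1) p l).
Proof.
move=> l0; case: p => a b; rewrite /centred_contour_sum /contour_sum /=.
have key (u : R) : - (l / 2) <= u <= l / 2 ->
    l^-1 <= (l / 2) / (u ^+ 2 + (l / 2) ^+ 2).
  move=> hu; rewrite ler_pdivlMr; last by rewrite ltr_wpDl ?sqr_ge0 ?exprn_gt0 //; lra.
  rewrite mulrC ler_pdivrMr //.
  have : 0 <= (l / 2 - u) * (l / 2 + u) by apply: mulr_ge0; lra.
  nra.
set m1 := midpoint_mean _ _ _ _; set m2 := midpoint_mean _ _ _ _.
set m3 := midpoint_mean _ _ _ _; set m4 := midpoint_mean _ _ _ _.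
have [k1 k2 k3 k4] : [/\ l^-1 <= complex.Im (1 * m1), l^-1 <= complex.Im ('i * m2),
    l^-1 <= complex.Im (-1 * m3) & l^-1 <= complex.Im (- 'i * m4)].
  rewrite /m1 /m2 /m3 /m4.
  split; apply: Im_midpoint_mean_ge => [|x hx]; try exact: ltW.
  - rewrite mul1r /=.
    have -> : b - l / 2 - b = - (l / 2) by ring.
    by rewrite sqrrN mulNr opprK; apply: key; lra.
  - rewrite /=.
    have -> : a - l / 2 + l - a = l / 2 by lra.
    rewrite mul0r mul1r add0r addrC; apply: key; lra.
  - rewrite mulN1r /=.
    have -> : b - l / 2 + l - b = l / 2 by lra.
    rewrite opprK; apply: key; lra.
  - rewrite /=.
    have -> : a - l / 2 - a = - (l / 2) by ring.
    rewrite oppr0 mul0r mulN1r mulNr opprK add0r sqrrN addrC; apply: key; lra.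
have -> : l%:C * (m1 + 'i * m2 - m3 - 'i * m4) =
    l%:C * (1 * m1 + 'i * m2 + -1 * m3 + - 'i * m4) by ring.
move: k1 k2 k3 k4.
move: (1 * m1) ('i * m2) (-1 * m3) (- 'i * m4) => [? k1] [? k2] [? k3] [? k4] /=.
move=> h1 h2 h3 h4.
have ll : l * l^-1 = 1 by rewrite mulfV // gt_eqF.
have := ler_wpM2l (ltW l0) (lerD (lerD (lerD h1 h2) h3) h4).
lra.
Qed.

(** The sums of [(g z - c) / (z - p)] tend to 0, so [c] times the sum of the Cauchy
kernel is comparable to the sum of [g z / (z - p)], which only involves boundary
values.  The value at [p] enters through the limit [c], so that [g] may be a
difference quotient at [p]. *)
Lemma centre_bound g p c l (M : R) : 0 < l ->
  (forall z, centred_square p l z -> z != p -> exists c', cderiv g z c') ->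
  (forall e : R, 0 < e -> exists2 d : R, 0 < d &
     forall z, z != p -> normc (z - p) < d -> normc (g z - c) <= e) ->
  (forall z, centred_boundary p l z -> normc (g z) <= M) ->
  normc c <= 2 * M.
Proof.
move=> l0 gd gc gM.
pose k z := (g z - c) / (z - p).
have kd z : centred_square p l z -> z != p -> exists c', cderiv k z c'.
  by move=> hz zp; have [c' gz] := gd z hz zp; apply: cderiv_quotient gz.
have kp (e : R) : 0 < e -> exists2 d : R, 0 < d &
    forall z, normc (z - p) < d -> normc (k z * (z - p)) <= e.
  move=> e0; have [d d0 dP] := gc e e0; exists d => // z zd.
  have [->|zp] := eqVneq z p; first by rewrite subrr mulr0 normc0 ltW.
  by rewrite /k divfK ?subr_eq0 //; apply: dP.
(* [4] bounds the sum of the kernel from below; [8 * M] is the perimeter times the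
   bound [2 * M / l] of [g z / (z - p)] on the boundary. *)
have lower N : 4 * normc c <= normc (centred_contour_sum N k p l) + 8 * M.
  have E : c * centred_contour_sum N (fun z => (z - p)^-1) p l =
     centred_contour_sum N (fun z => g z / (z - p)) p l
     + (-1) * centred_contour_sum N k p l.
    rewrite /centred_contour_sum -!contour_sumZ -contour_sumD.
    apply: eq_contour_sum => z.
    by rewrite /k; ring.
  have big : 4 * normc c <= normc (c * centred_contour_sum N (fun z => (z - p)^-1) p l).
    rewrite normcM mulrC ler_wpM2l ?normc_ge0 //.
    apply: le_trans (Im_contour_sum_inv N p l0) _.
    by apply: le_trans (ler_norm _) (Im_le_normc _).
  have small : normc (centred_contour_sum N (fun z => g z / (z - p)) p l) <= 8 * M.
    have -> : 8 * M = 4 * l * (2 * M / l) by field; lra.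
    apply: normc_contour_sum_le => [|z hz]; first exact: ltW.
    have far := centred_boundary_far hz.
    have M0 := le_trans (normc_ge0 _) (gM z hz).
    rewrite normcM normcV ler_pdivrMr; last lra.
    apply: le_trans (gM z hz) _.
    have {1}-> : M = 2 * M / l * (l / 2) by field; lra.
    by rewrite ler_wpM2l // divr_ge0 //; lra.
  apply: le_trans big _; rewrite E.
  apply: le_trans (normcD_le _ _) _.
  by rewrite mulN1r normcN; lra.
suff : 4 * normc c <= 8 * M by lra.
apply/ler_addgt0Pl => e e0.
have [N0 H] := goursat_punctured l0 kd kp e0.
by have := lower N0; have := H N0 (leqnn _); lra.
Qed.

Lemma cderiv_continuous f p c : cderiv f p c ->
  forall e : R, 0 < e -> exists2 d : R, 0 < d &
     forall z, normc (z - p) < d -> normc (f z - f p) <= e.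
Proof.
move=> fc e e0; have [d d0 dP] := fc 1 ltr01.
have c0 := normc_ge0 c.
exists (Num.min d (e / (1 + normc c))).
  by rewrite lt_min d0 divr_gt0 //; lra.
move=> z; rewrite lt_min ltr_pdivlMr; last lra.
move=> /andP[/dP h1 h2].
have -> : f z - f p = (f z - f p - c * (z - p)) + c * (z - p) by ring.
have := normcD_le (f z - f p - c * (z - p)) (c * (z - p)).
by rewrite normcM; lra.
Qed.

(** The derivative is the value at the centre of the difference quotient. *)
Lemma cauchy_estimate f p c l (M : R) : 0 < l ->
  (forall z, centred_square p l z -> exists c', cderiv f z c') ->
  cderiv f p c ->
  (forall z, centred_boundary p l z -> normc (f z) <= M) ->
  normc c <= 12 * M / l.
Proof.
move=> l0 fd fp fM.
have fpM : normc (f p) <= 2 * M.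
  apply: (centre_bound l0 _ _ fM) => [z hz _|e e0]; first exact: fd.
  by have [d d0 dP] := cderiv_continuous fp e0; exists d => // z _; apply: dP.
have -> : 12 * M / l = 2 * (3 * M * (2 / l)) by field; lra.
apply: (@centre_bound (fun z => (f z - f p) / (z - p)) p c l) => //.
- by move=> z hz zp; have [c' fz] := fd z hz; apply: cderiv_quotient fz.
- move=> e e0; have [d d0 dP] := fp e e0; exists d => // z zp /dP.
  have z0 : z - p != 0 by rewrite subr_eq0.
  have -> : (f z - f p) / (z - p) - c = (f z - f p - c * (z - p)) / (z - p) by field.
  by rewrite normcM normcV ler_pdivrMr ?normc_gt0.
move=> z hz; have far := centred_boundary_far hz; have := fM z hz => fz.
have M0 := le_trans (normc_ge0 _) fz.
rewrite normcM normcV ler_pdivrMr; last lra.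
apply: (@le_trans _ _ (3 * M)).
  by have := normcB_le (f z) (f p); lra.
have {1}-> : 3 * M = 3 * M * (2 / l) * (l / 2) by field; lra.
by rewrite ler_wpM2l // !mulr_ge0 ?invr_ge0 //; lra.
Qed.

(** The mean value inequality on the segment from 0 to 1.  The squares only serve
to reuse the subdivision principle, applied to the increments of [f] along
their lower sides. *)
Lemma cderiv_lipschitz f (L : R) :
  (forall z, square 0 0 1 z -> exists2 c, cderiv f z c & normc c <= L) ->
  normc (f 1 - f 0) <= L.
Proof.
move=> fd; apply/ler_addgt0Pl => e e0.
suff : normc (f ((0 + 1) +i* 0) - f (0 +i* 0)) <= (e + L) * 1.
  by rewrite add0r mulr1.
apply: (@square_induction R
  (fun s t l => normc (f ((s + l) +i* t) - f (s +i* t)) <= (e + L) * l)) => //.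
  move=> s t l l0 IH; pose m := l / 3.
  have t0 : t \in thirds t l by rewrite !inE eqxx.
  have h1 := IH s t ltac:(by rewrite !inE eqxx) t0.
  have h2 := IH (s + m) t ltac:(by rewrite !inE eqxx orbT) t0.
  have h3 := IH (s + m + m) t ltac:(by rewrite !inE eqxx !orbT) t0.
  rewrite -/m in h1 h2 h3.
  have -> : s + l = s + m + m + m by rewrite /m; lra.
  have -> : l = m + m + m by rewrite /m; lra.
  move: h1 h2 h3; set x0 := f (s +i* t); set x1 := f ((s + m) +i* t).
  set x2 := f ((s + m + m) +i* t); set x3 := f ((s + m + m + m) +i* t).
  have -> : x3 - x0 = (x3 - x2) + (x2 - x1) + (x1 - x0) by ring.
  have := normcD_le ((x3 - x2) + (x2 - x1)) (x1 - x0).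
  have := normcD_le (x3 - x2) (x2 - x1); lra.
move=> x y hx hy; have [c fc cL] := fd (x +i* y) (conj hx hy).
have [d d0 dP] := fc (e / 4) ltac:(lra).
exists (d / 2); first lra.
move=> s t l l0 ld hx' hy' _ _ _ _.
set p := x +i* y in fc dP.
have ps : square s t l p by [].
have s1 : square s t l ((s + l) +i* t) by rewrite /square /=; lra.
have s0 : square s t l (s +i* t) by rewrite /square /=; lra.
have q1 := square_diam s1 ps; have q0 := square_diam s0 ps.
set z1 := (s + l) +i* t in s1 q1 *; set z0 := s +i* t in s0 q0 *.
have r1 := dP z1 ltac:(lra); have r0 := dP z0 ltac:(lra).
have zz : z1 - z0 = l%:C by rewrite /z1 /z0; simpc; rewrite addrC addKr.
have -> : f z1 - f z0 = (f z1 - f p - c * (z1 - p)) - (f z0 - f p - c * (z0 - p))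
   + c * (z1 - z0) by ring.
have n1 := normcD_le
  ((f z1 - f p - c * (z1 - p)) - (f z0 - f p - c * (z0 - p))) (c * (z1 - z0)).
have n2 := normcB_le (f z1 - f p - c * (z1 - p)) (f z0 - f p - c * (z0 - p)).
have n3 : normc (c * (z1 - z0)) <= L * l.
  by rewrite zz normcM normcR (ger0_norm (ltW l0)) ler_wpM2r // ltW.
have m1 : e / 4 * normc (z1 - p) <= e / 4 * (2 * l) by rewrite ler_wpM2l //; lra.
have m0 : e / 4 * normc (z0 - p) <= e / 4 * (2 * l) by rewrite ler_wpM2l //; lra.
lra.
Qed.

End CauchyEstimates.

(** * Complex normed spaces and row vectors *)

Lemma differentiable_line (K : numFieldType) (V W : normedModType K)
    (f : V -> W) (x v : V) (t : K) : differentiable f (x + t *: v) ->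
  forall e : K, 0 < e -> exists2 d : K, 0 < d &
    forall z, `|z - t| < d ->
      `|f (x + z *: v) - f (x + t *: v) - (z - t) *: 'D_v f (x + t *: v)|
        <= e * `|z - t|.
Proof.
move=> /(diff_derivable (v := v)) /cvgrPdist_le df e e0.
have [d /= d0 dP] := df _ e0; exists d => // z zd.
have [->|zt] := eqVneq z t; first by rewrite !subrr scale0r subr0 !normr0 mulr0.
have zt0 : z - t != 0 by rewrite subr_eq0.
have := dP (z - t); rewrite /= sub0r normrN zt0 => /(_ zd isT).
rewrite -/(derive _ _ _).
have -> : (z - t) *: v + (x + t *: v) = x + z *: v.
  by rewrite addrCA -scalerDl subrK.
move=> h; rewrite mulrC; apply: le_trans (ler_wpM2l (normr_ge0 (z - t)) h).
by rewrite -normrZ scalerBr scalerA mulfV // scale1r -normrN opprB.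
Qed.

Section ComplexNorm.
Context {R : realType} {V : normedModType R[i]}.
Local Notation C := R[i].
Implicit Types (v w x : V) (A : set V).

(** The norm of a complex normed space takes its values among the nonnegative
elements of [R[i]]; its real part is the usual real norm. *)
Definition rnorm v : R := complex.Re `|v|.

Lemma rnormE v : `|v| = (rnorm v)%:C.
Proof. by rewrite /rnorm RRe_real ?ger0_real. Qed.

Lemma rnorm_ge0 v : 0 <= rnorm v.
Proof. by rewrite -ler0c -rnormE. Qed.

Lemma rnormD v w : rnorm (v + w) <= rnorm v + rnorm w.
Proof. by rewrite -lecR rmorphD /= -!rnormE ler_normD. Qed.

Lemma rnormN v : rnorm (- v) = rnorm v.
Proof. by rewrite /rnorm normrN. Qed.

Lemma rnormB v w : rnorm (v - w) <= rnorm v + rnorm w.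
Proof. by rewrite -(rnormN w) rnormD. Qed.

Lemma rnorm0 : rnorm 0 = 0.
Proof. by rewrite /rnorm normr0. Qed.

Lemma rnormZ (c : C) v : rnorm (c *: v) = normc c * rnorm v.
Proof.
rewrite {1}/rnorm normrZ rnormE -[`|c|]/((normc c)%:C).
by rewrite -[_%:C * _]/(_ +i* _) /= mulr0 subr0.
Qed.

Lemma rnorm_eq0 v : (rnorm v == 0) = (v == 0).
Proof. by rewrite -[RHS]normr_eq0 rnormE -(inj_eq (@complexI R)). Qed.

Lemma rnorm_gt0 v : v != 0 -> 0 < rnorm v.
Proof. by move=> v0; rewrite lt_neqAle rnorm_ge0 eq_sym rnorm_eq0 v0. Qed.

Lemma nbhs_rnormP x A : nbhs x A <->
  exists2 d : R, 0 < d & forall v, rnorm (v - x) < d -> A v.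
Proof.
split=> [/nbhs_normP[e /= e0 eA]|[d d0 dA]].
  have ee : e = (complex.Re e)%:C by rewrite RRe_real // gtr0_real.
  rewrite ee ltcR in e0; exists (complex.Re e) => // v vx; apply: eA => /=.
  by rewrite ee distrC rnormE ltcR.
apply/nbhs_normP; exists d%:C => /=; first by rewrite ltcR.
by move=> v /=; rewrite distrC rnormE ltcR; apply: dA.
Qed.

Lemma rnorm_continuous : continuous rnorm.
Proof.
move=> x; apply/cvgrPdist_lt => e e0; apply/nbhs_rnormP; exists e => // v vx.
have := rnormD (v - x) x; have := rnormB v (v - x).
rewrite subrK opprB addrC subrK => h1 h2.
by rewrite ltr_norml; apply/andP; split; lra.
Qed.

Lemma closed_annulus (a b : R) : closed [set v : V | a <= rnorm v <= b].
Proof.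
have -> : [set v : V | a <= rnorm v <= b] = rnorm @^-1` `[a, b]%classic.
  by apply/seteqP; split=> v /=; rewrite in_itv.
apply: preimage_closed; [by move=> v _; exact: rnorm_continuous | exact: interval_closed].
Qed.

End ComplexNorm.

Section RowVectors.
Context {R : realType} {n : nat}.
Local Notation C := R[i].
Local Notation V := ('rV[C]_n : normedModType C).
Implicit Types (v w x : V).

Lemma le_coord_norm (K : numFieldType) (z : 'rV[K]_n) (j : 'I_n) :
  `|z ord0 j| <= `|z|.
Proof.
rewrite [leRHS]/Num.norm /= mx_normE -[leLHS]nngE num_le.
exact: (le_bigmax _ (fun i : 'I_1 * 'I_n => `|z i.1 i.2|%:nng) (ord0, j)).
Qed.

Lemma normc_coord_le v j : normc (v ord0 j) <= rnorm v.
Proof. by rewrite -lecR -rnormE; apply: (@le_coord_norm C). Qed.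

Lemma rnorm_le_coord v (B : R) : 0 <= B ->
  (forall j, normc (v ord0 j) <= B) -> rnorm v <= B.
Proof.
move=> B0 vB; have [->|v0] := eqVneq v 0; first by rewrite rnorm0.
have : mx_norm v != 0 by rewrite (normr_eq0 v).
move=> /mx_norm_neq0[[i j] /= E].
rewrite -lecR -rnormE.
have -> : `|v| = `|v i j| := E.
by rewrite (ord1 i) lecR.
Qed.

Lemma cderiv_line (X : set V) (phi : V -> V) x v (t : C) j :
  holomorphic_on X phi -> X (x + t *: v) ->
  exists c, cderiv (fun t => phi (x + t *: v) ord0 j) t c.
Proof.
move=> hphi Xt; exists (('D_v phi (x + t *: v) : V) ord0 j) => e e0.
have [|d d0 dP] := differentiable_line (hphi _ Xt) (e := e%:C); first by rewrite ltcR.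
have dd : d = (complex.Re d)%:C by rewrite RRe_real // gtr0_real.
rewrite dd ltcR in d0; exists (complex.Re d) => // z zd.
have := dP z; rewrite dd -[`|z - t|]/((normc (z - t))%:C) ltcR => /(_ zd).
set D := 'D_v phi _; set a := phi _; set b := phi _.
rewrite rnormE -rmorphM /= lecR => h.
apply: le_trans (le_trans (normc_coord_le _ j) h).
by rewrite !mxE mulrC.
Qed.

(** The annulus is closed in a polydisc, which is compact because a bounded square
of complex numbers is the image of a square of the real plane. *)
Lemma compact_annulus (a b : R) : compact [set v : V | a <= rnorm v <= b].
Proof.
pose box := [set z : C^o | exists2 q : R * R,
  (`[- b, b] `*` `[- b, b])%classic q & q.1 +i* q.2 = z].
have box_compact : compact box.
  apply: (@continuous_compact _ _ (fun q : R * R => (q.1 +i* q.2 : C^o))).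
    apply: continuous_subspaceT => q.
    apply/cvgrPdist_le => e; case: e => e i; rewrite ltcE /= => /andP[/eqP -> e0].
    have e20 : 0 < e / 2 by lra.
    have c1 : (fun q' : R * R => q'.1) q' @[q' --> q] --> q.1 by apply: cvg_fst.
    have c2 : (fun q' : R * R => q'.2) q' @[q' --> q] --> q.2 by apply: cvg_snd.
    move: c1 c2 => /cvgrPdist_le /(_ _ e20) c1 /cvgrPdist_le /(_ _ e20) c2.
    near=> q'.
    have h1 : `|q.1 - q'.1| <= e / 2 by near: q'.
    have h2 : `|q.2 - q'.2| <= e / 2 by near: q'.
    rewrite -[X in X <= _]/((normc ((q.1 +i* q.2) - (q'.1 +i* q'.2)))%:C) lecR.
    apply: le_trans (normc_le_ReIm _ _) _; lra.
  by apply: compact_setX; apply: segment_compact.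
have box_rV : compact [set v : V | forall j, box (v ord0 j)].
  exact: (@rV_compact C^o n (fun=> box) (fun=> box_compact)).
apply: (subclosed_compact _ box_rV); first exact: closed_annulus.
move=> v /= /andP[_ vb] j.
have nv := le_trans (normc_coord_le v j) vb.
have := le_trans (Re_le_normc _) nv; have := le_trans (Im_le_normc _) nv.
rewrite /box; case: (v ord0 j) => x y /= hy hx; exists (x, y) => //=.
by rewrite !in_itv /= -!ler_norml.
Unshelve. all: by end_near. Qed.

End RowVectors.

(** * Maps of the punctured space near the puncture *)

Section PuncturedSpace.
Context {R : realType} {n : nat} (n2 : (2 <= n)%N).
Local Notation C := R[i].
Local Notation V := ('rV[C]_n : normedModType C).
Local Notation X := (punctured_space R n : set V).
Implicit Types (v w x y : V) (phi psi : V -> V).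

Definition unit_vector (k : 'I_n) : V := delta_mx ord0 k.

Lemma unit_vector_coord k j : (unit_vector k : 'rV_n) ord0 j = (j == k)%:R.
Proof. by rewrite mxE eqxx. Qed.

Lemma rnorm_unit_vector k : rnorm (unit_vector k) = 1.
Proof.
apply/eqP; rewrite eq_le; apply/andP; split.
  apply: rnorm_le_coord => // j; rewrite unit_vector_coord.
  by case: (j == k); rewrite ?normc0 ?normc1.
have := normc_coord_le (unit_vector k) k.
by rewrite unit_vector_coord eqxx normc1.
Qed.

(** This is where the dimension matters: the line through [x] in the direction of
the [k]-th unit vector misses 0, because its [i]-th coordinate is constant. *)
Lemma nonzero_coord x : x != 0 ->
  exists2 i, (x : 'rV_n) ord0 i != 0 & exists k : 'I_n, k != i.
Proof.
move=> x0; have [i xi] : exists i, (x : 'rV_n) ord0 i != 0.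
  apply: contrapT => no; move/eqP: x0; apply; apply/rowP => i.
  by rewrite mxE; apply/eqP; apply: contra_notT no => xi; exists i.
exists i => //.
have [->|i0] := eqVneq i (Ordinal (ltnW n2)); first by exists (Ordinal n2).
by exists (Ordinal (ltnW n2)); rewrite eq_sym.
Qed.

Lemma annulus_bound (a b : R) (f : V -> R) :
  {within [set v : V | a <= rnorm v <= b], continuous f} ->
  exists2 B : R, 0 < B & forall v, a <= rnorm v <= b -> f v <= B.
Proof.
move=> fc.
have cpt : compact (f @` [set v : V | a <= rnorm v <= b]).
  exact: continuous_compact fc (@compact_annulus R n a b).
have [M [_ MP]] := @compact_bounded R R^o _ cpt.
exists (Num.max 1 (M + 1)); first by rewrite lt_max ltr01.
move=> v hv; apply: le_trans (ler_norm _) _; rewrite le_max; apply/orP; right.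
by apply: MP; [rewrite ltrDl | exists v].
Qed.

Lemma holomorphic_norm_continuous phi x : holomorphic_on X phi -> x != 0 ->
  {for x, continuous (fun v => rnorm (phi v))}.
Proof.
move=> hphi x0; have dphi : differentiable phi x by apply: hphi.
have cphi := @differentiable_continuous _ V V x phi dphi.
exact: (@continuous_comp V V R^o phi rnorm x cphi (@rnorm_continuous R V (phi x))).
Qed.

(** Hartogs' phenomenon.  On a line through [x] that misses 0, the boundary of the
square of side 4 around [x] lies in a fixed annulus, where [phi] is bounded by
compactness. *)
Lemma bounded_near_0 phi : holomorphic_on X phi ->
  exists2 M : R, 0 < M & forall x, x != 0 -> rnorm x <= 1 -> rnorm (phi x) <= M.
Proof.
move=> hphi.
have [|B B0 BP] := @annulus_bound 1 5 (fun v => rnorm (phi v)).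
  apply: continuous_in_subspaceT => v; rewrite inE => /= /andP[v1 _].
  have v0 : v != 0 by rewrite -rnorm_eq0; apply/eqP; lra.
  exact: holomorphic_norm_continuous.
exists (2 * B); first lra.
move=> x x0 x1; apply: rnorm_le_coord => [|j]; first lra.
have [i xi [k ki]] := nonzero_coord x0.
pose e := unit_vector k.
have line0 (t : C) : X (x + t *: e).
  apply: contraNneq xi => /(congr1 (fun w : 'rV[C]_n => w ord0 i)).
  by rewrite !mxE (eq_sym i) (negbTE ki) andbF mulr0 addr0 => ->.
have hd (z : C) := cderiv_line j hphi (line0 z).
have -> : (phi x : 'rV_n) ord0 j = (phi (x + 0 *: e) : 'rV_n) ord0 j.
  by rewrite scale0r addr0.
apply: (@centre_bound _ (fun t => (phi (x + t *: e) : 'rV_n) ord0 j) 0 _ 4) => //.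
  move=> r r0; have [c hc] := hd 0.
  by have [d d0 dP] := cderiv_continuous hc r0; exists d => // z _; apply: dP.
move=> z hz; have := centred_boundary_far hz.
have := centred_square_near _ (boundary_square _ hz); rewrite subr0 => h4 h2.
have {}h4 := h4 ltac:(lra) ltac:(lra).
apply: le_trans (normc_coord_le _ j) _; apply: BP.
have nz : rnorm (z *: e) = normc z by rewrite rnormZ rnorm_unit_vector mulr1.
have := rnormD x (z *: e); have := rnormB (x + z *: e) x.
by rewrite addrAC subrr add0r nz; lra.
Qed.

(** Near 0, [psi] takes values in a bounded set.  They avoid the annulus
[e <= rnorm v <= M], because [phi] is bounded away from 0 on it whereas
[phi (psi y) = y] is small. *)
Lemma inverse_tends_to_0 phi psi : holomorphic_on X phi -> holomorphic_on X psi ->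
  (forall x, x != 0 -> phi x != 0) -> (forall y, y != 0 -> psi y != 0) ->
  (forall y, y != 0 -> phi (psi y) = y) ->
  forall e : R, 0 < e -> exists2 d : R, 0 < d &
    forall y, y != 0 -> rnorm y < d -> rnorm (psi y) < e.
Proof.
move=> hphi hpsi phi0 psi0 phiK e e0.
have [M M0 MP] := bounded_near_0 hpsi.
have [|B B0 BP] := @annulus_bound e M (fun v => (rnorm (phi v))^-1).
  apply: continuous_in_subspaceT => v; rewrite inE => /= /andP[v1 _].
  have v0 : v != 0 by rewrite -rnorm_eq0; apply/eqP; lra.
  have pv0 : rnorm (phi v) != 0 by rewrite rnorm_eq0 phi0.
  exact: (cvgV pv0 (holomorphic_norm_continuous hphi v0)).
exists (Num.min 1 B^-1); first by rewrite lt_min ltr01 invr_gt0.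
move=> y y0; rewrite lt_min => /andP[y1 yB]; rewrite ltNge; apply/negP => ey.
have := BP (psi y) ltac:(by rewrite ey MP // ltW).
by rewrite phiK // -[B]invrK lef_pV2 ?posrE ?invr_gt0 ?rnorm_gt0 // leNgt yB.
Qed.

(** The vector [y] is joined to a much smaller vector [y'] by the line of the
points [y + t *: (y' - y)], which misses 0.  This point stays in the unit ball
while [t] runs over squares of side about the inverse of [rnorm y].  The Cauchy
estimate bounds the derivative along the line by a multiple of [rnorm y], and
the value at [y'] is negligible.  The line through 0 and [y] itself would not
do, since [psi] is not known to be differentiable at 0. *)
Lemma linear_bound psi : holomorphic_on X psi ->
  (forall e : R, 0 < e -> exists2 d : R, 0 < d &
    forall y, y != 0 -> rnorm y < d -> rnorm (psi y) < e) ->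
  exists2 K : R, 0 < K &
    forall y, y != 0 -> rnorm y <= 1 / 16 -> rnorm (psi y) <= K * rnorm y.
Proof.
move=> hpsi psi0; have [M M0 MP] := bounded_near_0 hpsi.
exists (48 * M); first lra.
move=> y y0 y1; have Y0 := rnorm_gt0 y0.
apply: rnorm_le_coord => [|j]; first by rewrite mulr_ge0 //; lra.
apply/ler_addgt0Pl => e e0.
have [i yi [k ki]] := nonzero_coord y0.
have [d d0 dP] := psi0 e e0.
pose a := Num.min (d / 2) (rnorm y).
have a0 : 0 < a by rewrite lt_min Y0 divr_gt0.
have ay : a <= rnorm y by rewrite ge_min lexx orbT.
have ad : a < d by rewrite gt_min; apply/orP; left; lra.
pose y' : V := a%:C *: unit_vector k.
have y'n : rnorm y' = a by rewrite rnormZ rnorm_unit_vector mulr1 normcR gtr0_norm.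
have y'0 : y' != 0 by rewrite -rnorm_eq0 y'n gt_eqF.
have line0 (t : C) : X (y + t *: (y' - y)).
  have [->|t1] := eqVneq t 1.
    by rewrite scale1r addrC subrK.
  have : (y : 'rV_n) ord0 i * (1 - t) != 0.
    by rewrite mulf_neq0 // subr_eq0 eq_sym.
  apply: contraNneq => /(congr1 (fun w : 'rV[C]_n => w ord0 i)).
  rewrite !mxE (eq_sym i) (negbTE ki) andbF mulr0 add0r => <-.
  by apply/eqP; ring.
pose f t := (psi (y + t *: (y' - y)) : 'rV_n) ord0 j.
have hd (z : C) : exists c, cderiv f z c := cderiv_line j hpsi (line0 z).
have f0 : f 0 = (psi y : 'rV_n) ord0 j by rewrite /f scale0r addr0.
have f1 : normc (f 1) <= e.
  rewrite /f scale1r addrC subrK; apply: le_trans (normc_coord_le _ j) _.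
  by rewrite ltW // dP // y'n.
(* For [t] in a square of side [l] around a point of the unit square, the norm of
   [y + t *: (y' - y)] is at most [Y + (2 + l) * (2 * Y) = 5 * Y + 1 / 2]. *)
pose Y := rnorm y; pose l := (4 * Y)^-1.
have l0 : 0 < l by rewrite invr_gt0 mulr_gt0.
have lY : l * Y = 1 / 4 by rewrite /l; field; rewrite gt_eqF.
have main : normc (f 1 - f 0) <= 48 * M * Y.
  apply: cderiv_lipschitz => t ts; have [c hc] := hd t; exists c => //.
  have -> : 48 * M * Y = 12 * M / l by rewrite /l; field; rewrite gt_eqF.
  apply: (cauchy_estimate l0 _ hc) => [z _|z hz]; first exact: hd.
  apply: le_trans (normc_coord_le _ j) _; apply: MP; first exact: line0.
  have zt := centred_square_near l0 (boundary_square (ltW l0) hz).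
  have t2 : normc t <= 2.
    have s0 : square 0 0 1 (0 : C) by rewrite /square /=; lra.
    by have := square_diam ts s0; rewrite subr0; lra.
  have z2 : normc z <= 2 + l.
    by have := normcD_le (z - t) t; rewrite subrK; lra.
  have n1 := rnormD y (z *: (y' - y)); rewrite rnormZ in n1.
  have n3 : rnorm (y' - y) <= 2 * Y.
    by have := rnormB y' y; rewrite y'n -/Y; move: ay; rewrite -/Y; lra.
  have n4 := ler_pM (normc_ge0 z) (rnorm_ge0 (y' - y)) z2 n3.
  have : (2 + l) * (2 * Y) = 4 * Y + 2 * (l * Y) by ring.
  move: y1 n1; rewrite -/Y lY; lra.
rewrite -f0 -/Y; move: main f1; move: (f 0) (f 1) => b c main c1.
have -> : b = c - (c - b) by ring.
have := normcB_le c (c - b); lra.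
Qed.

(** * Sequences converging to the puncture *)

Lemma exhaustion_large_near_0 (rho : V -> R) (c : R) : exhaustion X rho ->
  exists2 d : R, 0 < d & forall x, x != 0 -> rnorm x < d -> c < rho x.
Proof.
move=> [_ _ /(_ c) cpt].
have cl := compact_closed (@norm_hausdorff _ V) cpt.
have : nbhs (0 : V) (~` sublevel X rho c).
  apply: open_nbhs_nbhs; split; first exact: closed_openC.
  by rewrite /sublevel /= => -[]; rewrite /punctured_space /= eqxx.
move=> /nbhs_rnormP[d d0 dP]; exists d => // x x0 xd.
have := dP x; rewrite subr0 => /(_ xd) h.
by rewrite ltNge; apply/negP => hx; apply: h.
Qed.

Lemma finite_closed (A : set V) : finite_set A -> closed A.
Proof.
have acc := hausdorff_accessible (@norm_hausdorff _ V).
exact: (iffLR accessible_finite_set_closed acc).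
Qed.

(** An automorphism shrinks the norm of small vectors at most by a constant factor,
and maps them to a bounded set.  The annulus with radii [rnorm x ^+ 2]
and [(rnorm x)^-1] eventually absorbs all such constants, so one function [zeta],
larger than [rho] on these annuli, defeats all automorphisms at once. *)
Lemma not_tame_near_0 (rho : V -> R) (D : set V) : exhaustion X rho ->
  (forall e : R, 0 < e -> exists2 x, D x & rnorm x < e) -> D `<=` X ->
  ~ tame X D.
Proof.
move=> hrho D0 DX [_ _ tameD].
have /choice[B BP] x : exists B : R, 0 <= B /\ (x != 0 -> forall y,
    rnorm x ^+ 2 <= rnorm y <= (rnorm x)^-1 -> rho y <= B).
  have [->|x0] := eqVneq x 0; first by exists 0.
  have [|B B0 BP] := @annulus_bound (rnorm x ^+ 2) (rnorm x)^-1 rho.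
    case: hrho => rc _ _; apply: continuous_subspaceW rc => y /= /andP[y1 _].
    rewrite /punctured_space /= -rnorm_eq0 gt_eqF //.
    by apply: lt_le_trans y1; rewrite exprn_gt0 // rnorm_gt0.
  by exists B; split; [exact: ltW | move=> _; exact: BP].
have [|phi [[phiX phi_inj phi_sur] hphi [psi [psiX psiK hpsi]]] phiB] :=
    tameD rho (fun x => B x + 1) hrho.
  by move=> x _; have [? _] := BP x; lra.
have phi0 x : x != 0 -> phi x != 0 by move=> x0; apply: phiX.
have psi0 x : x != 0 -> psi x != 0 by move=> x0; apply: psiX.
have psiphi x : x != 0 -> psi (phi x) = x by move=> x0; apply: psiK; rewrite inE.
have phipsi y : y != 0 -> phi (psi y) = y.
  by move=> y0; have [x x0 <-] := phi_sur y y0; rewrite psiphi.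
have [M M0 MP] := bounded_near_0 hphi.
have [K K0 KP] := linear_bound hpsi (inverse_tends_to_0 hphi hpsi phi0 psi0 phipsi).
pose e := Num.min (1 / 4) (Num.min M^-1 K^-1).
have [|x Dx] := D0 e; first by rewrite !lt_min !invr_gt0 M0 K0; lra.
rewrite !lt_min => /and3P[x4 xM xK].
have x0 : x != 0 := DX x Dx; have X0 := rnorm_gt0 x0.
have := phiB x Dx; have [_ /(_ x0 (phi x))] := BP x.
suff yA : rnorm x ^+ 2 <= rnorm (phi x) <= (rnorm x)^-1.
  by move=> /(_ yA); lra.
apply/andP; split; last first.
  apply: le_trans (MP x x0 _) _; first lra.
  by rewrite -[M]invrK lef_pV2 ?posrE ?invr_gt0 // ltW.
(* Outside the range of the linear bound, [rnorm x <= 1 / 4] suffices. *)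
have [y1|y1] := leP (rnorm (phi x)) (1 / 16).
  have := KP _ (phi0 _ x0) y1; rewrite psiphi // => xy.
  rewrite -(ler_pM2l K0); apply: le_trans xy.
  rewrite expr2 mulrA ger_pMl // ltW // mulrC -ltr_pdivlMr //; lra.
apply: le_trans (ltW y1).
have -> : 1 / 16 = (1 / 4) ^+ 2 :> R by field.
by rewrite lerXn2r ?nnegrE //; lra.
Qed.

(** Bounding [r i] for [i] up to [j.+1], rather than up to [j], turns the count of
terms below [r m] into the strict inequality that thresholds require. *)
Lemma sparse_null_sequence (rho : V -> R) (r : nat -> R) : exhaustion X rho ->
  exists x : nat -> V, forall j, [/\ x j != 0, rnorm (x j) < j.+1%:R^-1 &
    forall i, (i <= j.+1)%N -> r i < rho (x j)].
Proof.
move=> hrho; pose sparse j (x : V) := [/\ x != 0, rnorm x < j.+1%:R^-1 &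
  forall i, (i <= j.+1)%N -> r i < rho x].
suff /choice[x xP] j : exists x, sparse j x by exists x.
pose k0 := Ordinal (ltnW n2) : 'I_n.
have [d d0 dP] := exhaustion_large_near_0 (\sum_(i < j.+2) `|r i|) hrho.
pose a := Num.min d (j.+1%:R^-1) / 2.
have m0 : 0 < Num.min d (j.+1%:R^-1) by rewrite lt_min d0 invr_gt0 ltr0n.
have a0 : 0 < a by rewrite /a; lra.
have am : a < Num.min d (j.+1%:R^-1) by rewrite /a; lra.
move: am; rewrite lt_min => /andP[ad aj].
have na : rnorm (a%:C *: unit_vector k0) = a.
  by rewrite rnormZ rnorm_unit_vector mulr1 normcR gtr0_norm.
have nz : a%:C *: unit_vector k0 != 0 by rewrite -rnorm_eq0 na gt_eqF.
exists (a%:C *: unit_vector k0); split => //; first by rewrite na.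
move=> i ij; apply: le_lt_trans (dP _ nz _); last by rewrite na.
apply: le_trans (ler_norm _) _.
rewrite (bigD1 (Ordinal (ij : (i < j.+2)%N))) //= lerDl.
by apply: sumr_ge0.
Qed.

Section NullSequence.
Context (x : nat -> V) (x0 : forall j, x j != 0).
Context (xlim : forall e : R, 0 < e -> exists N, forall j, (N <= j)%N -> rnorm (x j) < e).

Lemma null_sequence_infinite : infinite_set (range x).
Proof.
move=> /finite_closed cl.
have : nbhs (0 : V) (~` range x).
  apply: open_nbhs_nbhs; split; first exact: closed_openC.
  by move=> [j _ xj]; have := x0 j; rewrite xj eqxx.
move=> /nbhs_rnormP[d d0 dP]; have [N NP] := xlim d0.
by apply: (dP (x N)); [rewrite subr0; exact: NP | exists N].
Qed.

Lemma null_sequence_discrete : discrete_in X (range x).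
Proof.
split; first by move=> _ [j _ <-]; apply: x0.
apply/seteqP; split => // p [p0 lim].
have P0 := rnorm_gt0 p0.
have [N NP] := xlim (divr_gt0 P0 (ltr0n R 2)).
(* Only the terms before [N] can be close to [p]. *)
pose F := (x @` `I_N) `\ p.
have Fcl : closed F.
  by apply: finite_closed; apply: finite_setD; apply: finite_image.
have : nbhs p (~` F `&` [set v | rnorm (v - p) < rnorm p / 2]).
  apply: filterI.
    apply: open_nbhs_nbhs; split; first exact: closed_openC.
    by move=> [_ /=]; apply.
  by apply/nbhs_rnormP; exists (rnorm p / 2) => //; lra.
move=> /lim[v [vp [j _ xj] [nF /= h]]]; apply: nF; split; last exact/eqP.
rewrite -{}xj in vp h *.
exists j => //=; rewrite ltnNge; apply/negP => /NP.
have := rnormB (x j) (x j - p); rewrite opprB addrC subrK; lra.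
Qed.

End NullSequence.

End PuncturedSpace.

Theorem corollary6p3 (R : realType) (n : nat) (hn : (2 <= n)%N)
    (rho : 'rV[R[i]]_n -> R) (hrho : exhaustion (punctured_space R n) rho) :
  ~ exists r : nat -> R, threshold_sequence (punctured_space R n) rho r.
Proof.
move=> [r [_ thr]]; have [x xP] := sparse_null_sequence hn r hrho.
have x0 j : x j != 0 by have [] := xP j.
have xlim (e : R) : 0 < e -> exists N, forall j, (N <= j)%N -> rnorm (x j) < e.
  move=> e0; have := @near_infty_natSinv_lt R (PosNum e0).
  move=> [N _ NP]; exists N => j Nj; have [_ h _] := xP j.
  by apply: lt_trans h _; apply: NP.
apply: (not_tame_near_0 hn hrho (D := range x)).
- by move=> e /xlim[N NP]; exists (x N); [exists N | exact: NP].
- by move=> _ [j _ <-]; apply: x0.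
apply: thr; [exact: null_sequence_infinite|exact: null_sequence_discrete|].
move=> m m1; pose A := sublevel (range x) rho (r m).
have sub : (A #<= `I_m.-1)%card.
  apply: (@card_le_trans _ _ _ (x @` `I_m.-1)); last exact: card_image_le.
  apply: subset_card_le => _ [[j _ <-] hj].
  exists j => //=; have [_ _ /(_ m) h] := xP j.
  rewrite ltnNge; apply/negP => mj.
  have : r m < rho (x j) by apply: h; rewrite -(prednK m1) ltnS.
  by rewrite ltNge hj.
have /finite_setP[k Ak] : finite_set A by apply/finite_set_leP; exists m.-1.
exists k => //; rewrite -(prednK m1) ltnS -card_le_II.
apply: card_le_trans sub; move: Ak.
by rewrite card_eq_le => /andP[].
Qed.
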